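(* Let $\mathcal{T}$ be a finite set of $\mathbb{R}^d$-tiles that has finite local complexity. If every $\mathcal{T}$-tiling $x$ of $\mathbb{R}^d$ is periodic (i.e. its stabilizer $\{v \in \mathbb{R}^d : v+x=x\}$ is cocompact in $\mathbb{R}^d$), then there are only finitely many $\mathcal{T}$-tilings of $\mathbb{R}^d$ up to translation.
   Context: An $\mathbb{R}^d$-tile is a compact set $T \subset \mathbb{R}^d$ that equals the closure of its interior; by convention $0$ is in the interior of every tile. For a finite set $\mathcal{T}$ of tiles, a $\mathcal{T}$-tiling of $\mathbb{R}^d$ is a family $x = (x_T)_{T \in \mathcal{T}}$ of closed subsets $x_T \subset \mathbb{R}^d$ such that (1) $\mathbb{R}^d = \bigcup_{T\in\mathcal{T}} \bigcup_{v \in x_T} (v+T)$, and (2) whenever $v_1 \in x_{T_1}$ and $v_2 \in x_{T_2}$, either $v_1=v_2$ and $T_1=T_2$, or $v_1+T_1$ and $v_2+T_2$ have disjoint interiors. $X_{\mathcal{T}}$ is the set of all $\mathcal{T}$-tilings, and $\mathbb{R}^d$ acts on it by $(v+x)_T = \{v+w : w\in x_T\}$; ''up to translation'' means up to orbits of this action. For $x \in X_{\mathcal{T}}$ let $E_x$ be the set of pairs $(v_1,v_2)$ for which there exist $T_1,T_2\in\mathcal{T}$ with $v_1 \in x_{T_1}$, $v_2 \in x_{T_2}$ and $(v_1+T_1)\cap(v_2+T_2) \neq \emptyset$. The set of admissible displacement vectors is $E_{\mathcal{T}} = \{v-w : (v,w) \in E_x,\ x \in X_{\mathcal{T}}\}$.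 $\mathcal{T}$ has finite local complexity if $E_{\mathcal{T}}$ is finite. *)

(* Defs.v *)
From HB Require Import structures.
From mathcomp Require Import all_boot all_order all_algebra.
From mathcomp Require Import all_classical all_reals all_analysis.
Import Order.TTheory GRing.Theory Num.Theory.
Import numFieldNormedType.Exports.

Set Implicit Arguments.
Unset Strict Implicit.
Unset Printing Implicit Defensive.

Local Open Scope classical_set_scope.
Local Open Scope ring_scope.

Definition translate (R : realType) (d : nat) (v : 'rV[R]_d)
    (A : set 'rV[R]_d) : set 'rV[R]_d :=
  [set v + w | w in A].

Definition tile (R : realType) (d : nat) (T : set 'rV[R]_d) : Prop :=
  [/\ compact T, T = closure (interior T) & interior T 0].

(* `tiles` is coerced to the subtype of its elements, so that a family has
   exactly one component per tile. *)
Definition tile_family (R : realType) (d : nat)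
    (tiles : set (set 'rV[R]_d)) : Type :=
  tiles -> set 'rV[R]_d.

Definition tiling (R : realType) (d : nat) (tiles : set (set 'rV[R]_d))
    (x : tile_family tiles) : Prop :=
  [/\ forall T : tiles, closed (x T),
      [set: 'rV[R]_d] =
        \bigcup_(T in [set: tiles]) \bigcup_(v in x T) translate v (val T)
    & forall (T1 T2 : tiles) (v1 v2 : 'rV[R]_d), x T1 v1 -> x T2 v2 ->
        (v1 = v2 /\ T1 = T2) \/
        interior (translate v1 (val T1)) `&` interior (translate v2 (val T2))
          = set0].

Definition translate_family (R : realType) (d : nat)
    (tiles : set (set 'rV[R]_d))
    (v : 'rV[R]_d) (x : tile_family tiles) : tile_family tiles :=
  fun T => translate v (x T).

Definition translation_orbit (R : realType) (d : nat)
    (tiles : set (set 'rV[R]_d))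
    (x : tile_family tiles) : set (tile_family tiles) :=
  [set translate_family v x | v in [set: 'rV[R]_d]].

Definition stabilizer (R : realType) (d : nat) (tiles : set (set 'rV[R]_d))
    (x : tile_family tiles) : set 'rV[R]_d :=
  [set v | translate_family v x = x].

Definition adjacency (R : realType) (d : nat) (tiles : set (set 'rV[R]_d))
    (x : tile_family tiles) : set ('rV[R]_d * 'rV[R]_d) :=
  [set p | exists T1 T2 : tiles,
     [/\ x T1 p.1, x T2 p.2 &
         translate p.1 (val T1) `&` translate p.2 (val T2) !=set0]].

Definition displacements (R : realType) (d : nat)
    (tiles : set (set 'rV[R]_d)) : set 'rV[R]_d :=
  [set u | exists x : tile_family tiles, tiling x /\
     exists2 p, adjacency x p & u = p.1 - p.2].

Definition finite_local_complexity (R : realType) (d : nat)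
    (tiles : set (set 'rV[R]_d)) : Prop :=
  finite_set (displacements tiles).

Section StabilizerQuotient.
Variables (R : realType) (d : nat) (tiles : set (set 'rV[R]_d)).
Implicit Types (x : tile_family tiles) (u v w : 'rV[R]_d).

Lemma translate_family0 x : translate_family 0 x = x.
Proof.
apply/funext => T; apply/seteqP; split => [_ [w xw <-]|w xw].
  by rewrite add0r.
by exists w => //; rewrite add0r.
Qed.

Lemma translate_familyD u v x :
  translate_family (u + v) x = translate_family u (translate_family v x).
Proof.
apply/funext => T; apply/seteqP; split => [_ [w xw <-]|_ [_ [w xw <-] <-]].
  by exists (v + w); [exists w | rewrite addrA].
by exists w => //; rewrite addrA.
Qed.

Definition same_coset x : rel 'rV[R]_d :=
  fun v w => `[< stabilizer x (v - w) >].

Lemma same_coset_equiv x : equiv_class_of (same_coset x).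
Proof.
have sN u : stabilizer x u -> stabilizer x (- u).
  by rewrite /stabilizer /= => xu; rewrite -[in LHS]xu -translate_familyD addNr
    translate_family0.
apply: EquivClass => [v|v w|u v w].
- by apply/asboolP; rewrite subrr; exact: translate_family0.
- by apply/asboolP/asboolP => /sN; rewrite opprB.
- move=> /asboolP vu /asboolP uw; apply/asboolP.
  rewrite /stabilizer /= in vu uw *.
  by rewrite -(subrKA u) translate_familyD uw vu.
Qed.

Canonical same_coset_equiv_rel x := EquivRelPack (same_coset_equiv x).

End StabilizerQuotient.

Definition stabilizer_quotient (R : realType) (d : nat)
    (tiles : set (set 'rV[R]_d)) (x : tile_family tiles) : topologicalType :=
  quotient_topology {eq_quot (same_coset_equiv_rel x)}%qT.

(* Cocompactness of the stabilizer: the quotient space is compact. *)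
Definition periodic_tiling (R : realType) (d : nat) (tiles : set (set 'rV[R]_d))
    (x : tile_family tiles) : Prop :=
  compact [set: stabilizer_quotient x].

(* Main.v *)
Require Import Defs.
From HB Require Import structures.
From mathcomp Require Import all_boot all_order all_algebra.
From mathcomp Require Import all_classical all_reals all_analysis.
From mathcomp Require Import finmap lra.
Import numFieldNormedType.Exports.
Import Order.TTheory GRing.Theory Num.Theory.

(** Fix a tiling [x] and call the points of its components vertices.  Every
    orbit of tilings contains a rooted one, i.e. one with a vertex at the origin
    ([rooted]), so it suffices to see that there are finitely many rooted
    tilings ([finite_rooted]).

    Compactness.  Vertices of a tiling are uniformly separated, so a segment of
    bounded length meets boundedly many tiles; as the segment is connected,
    these tiles form a chain of neighbours.  Hence a vertex of norm at most
    [rho] in a rooted tiling is a sum of a bounded number of admissible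
    displacements, and by finite local complexity only finitely many points are
    vertices of norm at most [rho] of some rooted tiling
    ([finite_rooted_vertices]).  Two consequences: if tilings agreeing on some
    fixed ball were always equal, there would be finitely many of them
    ([finite_rooted_of_agree]); and any sequence of rooted tilings converges
    along an ultrafilter to a rooted tiling, the convergence being equality on
    large balls ([ultralimit_agree], [ultralimit_rooted]).

    Rigidity.  Two tilings with cocompact stabilizers that agree on balls of
    arbitrarily large radius, anywhere in space, are equal
    ([periodic_eq_of_agree]).  Indeed, let [u] be a period of [y].  On the part
    of a large ball that stays in the ball under translation by [- u], the
    translate [u + x] agrees with [x], because both agree with [y].  Both [x]
    and [u + x] are invariant under the stabilizer of [x], so agreement on one
    large ball spreads everywhere and [u] is a period of [x].  So all periods of
    [y] are periods of [x], and the agreement of [x] and [y] spreads in the same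
    way.

    Conclusion.  If there were infinitely many rooted tilings, then for every
    [n] two distinct ones would agree on the ball of radius [n].  Translate such
    a pair so that the origin becomes a common vertex close to a place of
    disagreement which is nearest to the old origin ([recentre]): the new pair
    disagrees within a fixed distance of the origin, but agrees on a ball of
    radius [m] whose centre has norm at most [m], for each [m <= n].  Both
    properties survive in the limit over [n], and the limit tilings are periodic
    by assumption: this contradicts rigidity. *)

Set Implicit Arguments.
Unset Strict Implicit.
Unset Printing Implicit Defensive.

Local Open Scope classical_set_scope.
Local Open Scope ring_scope.

(** * Sets, filters and connectedness *)

Lemma finite_subsets (T : choiceType) (A : set T) :
  finite_set A -> finite_set [set B | B `<=` A].
Proof.
move=> /finite_fsetP[F ->].
apply: (@sub_finite_set _ _ ((fun G : {fset T} => [set` G]) @` [set` fpowerset F])).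
  move=> B BF; exists [fset x in F | `[< B x >]]%fset; last first.
    apply/seteqP; split=> x /=; rewrite !inE /=.
      by case/andP=> _ /asboolP.
    by move=> Bx; rewrite (BF x Bx); apply/asboolP.
  rewrite /= fpowersetE; apply/fsubsetP => x; rewrite !inE /=.
  by case/andP.
by apply: finite_image; exact: finite_fset.
Qed.

Lemma filter_finite_bigcap (I : choiceType) (X : Type) (D : set I)
    (f : I -> set X) (F : set_system X) {FF : Filter F} : finite_set D ->
  (forall i, D i -> F (f i)) -> F (\bigcap_(i in D) f i).
Proof. by move=> /finite_fsetP[G ->] Ff; exact: filter_bigI. Qed.

Lemma connected_sub_closed (X : topologicalType) (S A B : set X) :
  connected S -> closed A -> closed B -> S `<=` A `|` B ->
  (forall p, A p -> B p -> False) -> S `&` A !=set0 -> S `<=` A.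
Proof.
move=> Sc clA clB SAB AB SA.
suff SAE : S `&` A = S by rewrite -SAE => p [].
apply: Sc => //; last by exists A.
exists (~` B); first exact: closed_openC.
apply/seteqP; split=> p [Sp]; first by move=> Ap; split=> // /(AB _ Ap).
by move=> nBp; have [] := SAB p Sp.
Qed.

(** * Translations and balls *)

Section Space.
Variables (R : realType) (d : nat).
Implicit Types (v w p : 'rV[R]_d) (A : set 'rV[R]_d) (E : set 'rV[R]_d).

Lemma translateE v A w : translate v A w = A (w - v).
Proof.
apply/propext; split=> [[a Aa <-]|Awv].
  by rewrite addrC addKr.
by exists (w - v) => //; rewrite addrC subrK.
Qed.

Lemma shift_continuous v : continuous (fun w : 'rV[R]_d => w - v).
Proof. by move=> w; exact: cvgB (@cvg_id _ (nbhs w)) (cvg_cst v). Qed.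

Lemma closed_translate v A : closed A -> closed (translate v A).
Proof.
move=> clA; have -> : translate v A = (fun w => w - v) @^-1` A.
  by apply/funext => w; rewrite translateE.
exact: (continuous_closedP _).1 (@shift_continuous v) _ clA.
Qed.

Lemma interior_translate v A :
  interior (translate v A) = translate v (interior A).
Proof.
apply/funext => w; rewrite translateE; apply/propext.
split=> Aw; rewrite /interior /=.
- have := @shift_continuous (- v) (w - v) (translate v A).
  rewrite /= opprK subrK => /(_ Aw) cv.
  apply: (@filterS _ (nbhs (w - v)) _ ((fun p => p + v) @^-1` translate v A)).
    by move=> p /=; rewrite translateE addrK.
  exact: cv.
- apply: (@filterS _ (nbhs w) _ ((fun p => p - v) @^-1` A)).
    by move=> p /=; rewrite translateE.
  exact: shift_continuous.
Qed.

Lemma near0_normP A : nbhs (0 : 'rV[R]_d) A ->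
  exists2 r : R, 0 < r & forall v, `|v| < r -> A v.
Proof.
move=> /nbhs_normP[r /= r0 rA]; exists r => // v vr; apply: rA => /=.
by rewrite sub0r normrN.
Qed.

(** The covering form of compactness is applied to the filter of all finite
    lists, ordered by inclusion: a point of the ball is close to an element of
    every list that contains the centre of a small ball around it. *)
Lemma ball_finite_net (rho eps : R) : 0 < eps ->
  exists s : seq 'rV[R]_d,
    forall v, `|v| <= rho -> exists2 c, c \in s & `|v - c| < eps.
Proof.
move=> eps0; pose K := [set v : 'rV[R]_d | `|v| <= rho].
have cK : compact K.
  apply: bounded_closed_compact.
    exists rho; split; first exact: num_real.
    by move=> M rM v Kv; apply: le_trans (ltW rM).
  rewrite (_ : K = closed_ball_ Num.Def.normr 0 rho).
    exact: closed_closed_ball_.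
  by apply/funext => v; rewrite /closed_ball_ /= sub0r normrN.
have /compact_near_coveringP nK := cK.
pose F : set_system (seq 'rV[R]_d) :=
  [set P | exists s : seq 'rV[R]_d, forall t : seq 'rV[R]_d, {subset s <= t} -> P t].
have FF : Filter F.
  split.
  - by exists [::].
  - move=> P Q [s sP] [t tQ]; exists (s ++ t) => l stl; split.
      by apply: sP => c cs; apply: stl; rewrite mem_cat cs.
    by apply: tQ => c ct; apply: stl; rewrite mem_cat ct orbT.
  - by move=> P Q PQ [s sP]; exists s => t /sP/PQ.
have [s sK] : F [set s : seq 'rV[R]_d |
    forall v, K v -> exists2 c, c \in s & `|v - c| < eps].
  apply: (nK _ F (fun (s : seq 'rV[R]_d) v =>
    exists2 c, c \in s & `|v - c| < eps)) => v Kv.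
  exists ([set w | `|w - v| < eps], [set t | v \in t]); last first.
    by move=> [w t] [/= wv vt]; exists v.
  split; last by exists [:: v] => t /(_ v); apply; rewrite mem_head.
  by rewrite /=; apply/(nbhs_normP v); exists eps => // w /=; rewrite distrC.
by exists s; exact: sK.
Qed.

(** A finite net of mesh [eps / 2] meets [S] at most once near each of its
    points. *)
Lemma finite_separated (S : set 'rV[R]_d) (rho eps : R) : 0 < eps ->
  (forall v, S v -> `|v| <= rho) ->
  (forall v w, S v -> S w -> `|v - w| < eps -> v = w) ->
  finite_set S.
Proof.
move=> eps0 Srho Ssep; have eps20 : 0 < eps / 2 by lra.
have [s sP] := @ball_finite_net rho (eps / 2) eps20.
pose g c := get [set v | S v /\ `|v - c| < eps / 2].
apply: (@sub_finite_set _ _ (g @` [set` s])); last first.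
  by apply: finite_image; exact: finite_seq.
move=> v Sv; have [c cs vc] := sP v (Srho v Sv).
exists c => //; have [Sg gc] : [set v | S v /\ `|v - c| < eps / 2] (g c).
  by apply: getPex; exists v.
apply: Ssep => //; apply: le_lt_trans (ler_distD c _ _) _.
by rewrite (splitr eps) ltrD // distrC.
Qed.

Lemma segment_connected_rV v :
  connected [set t *: v | t in `[0, 1 : R]%classic].
Proof.
apply: connected_continuous_connected; first exact: segment_connected.
apply: continuous_subspaceT => t.
exact: (@cvgZ _ _ _ _ _ (fun t : R => t) (fun=> v) t v cvg_id (cvg_cst v)).
Qed.

Fixpoint sumset (E : set 'rV[R]_d) (k : nat) : set 'rV[R]_d :=
  if k is k'.+1 then [set u + v | u in E & v in sumset E k'] else [set 0].

Lemma finite_sumset (E : set 'rV[R]_d) k : finite_set E -> finite_set (sumset E k).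
Proof.
by move=> fE; elim: k => [|k IHk]; [exact: finite_set1|exact: finite_image2].
Qed.

Lemma sumset_le (E : set 'rV[R]_d) k l : E 0 -> (k <= l)%N ->
  sumset E k `<=` sumset E l.
Proof.
move=> E0 /subnKC <-; elim: (l - k)%N => [|n IHn]; first by rewrite addn0.
by move=> v /IHn Ev; rewrite addnS; exists 0 => //; exists v => //; rewrite add0r.
Qed.

End Space.

(** * Families with many periods *)

Section Families.
Variables (R : realType) (d : nat) (tiles : set (set 'rV[R]_d)).
Implicit Types (x y : tile_family tiles) (u v w p c : 'rV[R]_d) (T : tiles).

Lemma translate_familyE v x T w : translate_family v x T w = x T (w - v).
Proof. exact: translateE. Qed.

Lemma stabilizerE x u T v : stabilizer x u -> x T (v - u) = x T v.
Proof. by move=> xu; rewrite -translate_familyE xu. Qed.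

Definition agree c (r : R) x y :=
  forall T v, `|v - c| <= r -> (x T v <-> y T v).

Definition relatively_dense (P : set 'rV[R]_d) (rho : R) :=
  forall v, exists2 w, P w & `|v - w| <= rho.

(** The images in the quotient of the open balls around the origin form an
    increasing open cover: the preimage of such an image is the union of the
    translates of the ball by periods.  By compactness one ball already
    represents every coset. *)
Lemma periodic_relatively_dense x : periodic_tiling x ->
  exists rho : R, relatively_dense (stabilizer x) rho.
Proof.
rewrite /periodic_tiling compact_near_coveringP => cX.
pose Q := stabilizer_quotient x.
pose P (n : nat) (q : Q) := exists2 v : 'rV[R]_d, `|v| < n%:R & q = \pi_Q%qT v.
have [n _ nP] : \forall n \near \oo, [set: Q] `<=` P n.
  apply: cX => q _.
  pose n := (Num.truncn `|repr q|).+1.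
  have qn : P n q by exists (repr q); [exact: truncnS_gt|rewrite reprK].
  exists (P n, [set m | (n <= m)%N]); last first.
    move=> [q' m] /= [[v vn ->] nm]; exists v => //.
    by apply: lt_le_trans vn _; rewrite ler_nat.
  split; last by exists n.
  apply: open_nbhs_nbhs; split=> //.
  (* A set of cosets is open when its preimage under the projection is. *)
  have : open (\pi_Q%qT @^-1` P n); last by [].
  rewrite openE => v [w wn /eqmodP/asboolP vw].
  rewrite /interior; apply/(nbhs_normP v); exists (n%:R - `|w|).
    by rewrite /= subr_gt0.
  move=> v' /= vv'; exists (v' - (v - w)).
    rewrite opprB addrCA; apply: le_lt_trans (ler_normD _ _) _.
    by rewrite -ltrBrDl distrC.
  by apply/eqmodP/asboolP; rewrite opprB addrC subrK.
exists n%:R => v; have [||w wn /eqmodP vw] := nP n _ (\pi_Q%qT v) => //=.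
exists (v - w); last by rewrite opprB addrC subrK ltW.
by move/asboolP: vw.
Qed.

(** Common periods move any point into the ball of agreement. *)
Lemma eq_of_agree x y c rho :
  relatively_dense (stabilizer x `&` stabilizer y) rho ->
  agree c rho x y -> x = y.
Proof.
move=> dense xy; apply/funext => T; apply/seteqP.
suff xyE v : x T v <-> y T v by split=> v /xyE.
have [w [xw yw] vcw] := dense (v - c).
rewrite -(stabilizerE T v xw) -(stabilizerE T v yw); apply: xy.
by rewrite addrAC.
Qed.

(** For a period [u] of [y], the families [u + x] and [x] share the periods of
    [x], and both agree with [y] on a large ball, up to a margin of [`|u|]. *)
Lemma stabilizer_sub_of_agree x y rho :
  relatively_dense (stabilizer x) rho ->
  (forall r : R, exists c, agree c r x y) ->
  stabilizer y `<=` stabilizer x.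
Proof.
move=> dense xy u yu.
have [c xyc] := xy (rho + `|u|).
apply: (@eq_of_agree _ _ c rho).
  move=> v; have [w xw vw] := dense v; exists w => //; split=> //.
  by rewrite /stabilizer /= -translate_familyD addrC translate_familyD xw.
move=> T v vc; rewrite translate_familyE.
have vc' : `|v - c| <= rho + `|u| by rewrite ler_wpDr.
rewrite (xyc T v vc') -(stabilizerE T v yu); apply: xyc.
by rewrite addrAC; apply: le_trans (ler_normB _ _) _; rewrite lerD2r.
Qed.

(** Agreement on large balls forces the periods of [y] to be common periods,
    although the two stabilizers need not be commensurable a priori. *)
Lemma periodic_eq_of_agree x y : periodic_tiling x -> periodic_tiling y ->
  (forall r : R, exists c, agree c r x y) -> x = y.
Proof.
move=> /periodic_relatively_dense[rx dx] /periodic_relatively_dense[ry dy] xy.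
have yx := stabilizer_sub_of_agree dx xy.
have [c xyc] := xy ry; apply: eq_of_agree xyc => v.
by have [w yw vw] := dy v; exists w => //; split=> //; exact: yx.
Qed.

End Families.

(** * Local finiteness of tilings *)

Section Tilings.
Variables (R : realType) (d : nat) (tiles : set (set 'rV[R]_d)).
Hypothesis tiles_finite : finite_set tiles.
Hypothesis tilesP : forall T, tiles T -> tile T.
Implicit Types (x y : tile_family tiles) (u v w p c : 'rV[R]_d) (T : tiles).

Lemma tiling_translate v x : tiling x -> tiling (translate_family v x).
Proof.
case=> xcl xcov xdisj; split.
- by move=> T; exact: closed_translate.
- apply/seteqP; split=> // p _.
  have : [set: 'rV[R]_d] (p - v) by [].
  rewrite xcov => -[T _ [w xw]]; rewrite translateE => Tw.
  exists T => //; exists (w + v); first by rewrite translate_familyE addrK.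
  by rewrite translateE opprD addrCA addrC.
- move=> T1 T2 v1 v2; rewrite !translate_familyE => x1 x2.
  have [[/addIr -> ->]|disj] := xdisj _ _ _ _ x1 x2; [by left|right].
  apply/seteqP; split=> // p [].
  rewrite !interior_translate !translateE => T1p T2p.
  suff : (interior (translate (v1 - v) (val T1)) `&`
          interior (translate (v2 - v) (val T2))) (p - v) by rewrite disj.
  by split; rewrite interior_translate translateE opprB addrA subrK.
Qed.

Lemma finite_tile_type : finite_set [set: tiles].
Proof.
rewrite (_ : setT = val @^-1` tiles).
  by apply: finite_preimage => // T1 T2 _ _; exact: val_inj.
by apply/seteqP; split=> // T _; exact: set_valP.
Qed.

Lemma tile_val T : tile (val T).
Proof. by apply: tilesP; exact: set_valP. Qed.

Lemma tile_mem0 T : val T 0.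
Proof. by have [_ _ /interior_subset] := tile_val T. Qed.

Lemma tile_closed T : closed (val T).
Proof. by have [/compact_closed cl _ _] := tile_val T; apply: cl. Qed.

(** Constants attached to single tiles are made uniform by taking a maximum over
    the finitely many tiles, hence the monotonicity in the hypothesis. *)
Lemma uniform_tile_const (P : nat -> tiles -> Prop) :
  (forall T, exists n, forall m, (n <= m)%N -> P m T) ->
  exists n, forall T, P n T.
Proof.
move=> PT; have [F FE] := finite_fsetP.1 finite_tile_type.
have [f fP] := choice PT.
exists (\max_(T <- F) f T)%N => T; apply: fP.
have TF : T \in F by have : [set: tiles] T by []; rewrite FE.
by rewrite (big_rem T) //= leq_maxl.
Qed.

Lemma tiles_inradius :
  exists2 r : R, 0 < r & forall T v, `|v| < r -> interior (val T) v.
Proof.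
have [|n nP] := @uniform_tile_const
  (fun n T => forall v, `|v| < n.+1%:R^-1 -> interior (val T) v).
  move=> T; have [_ _ T0] := tile_val T.
  have [r r0 rT] : exists2 r : R, 0 < r & forall v, `|v| < r -> interior (val T) v.
    by apply: near0_normP; apply: open_nbhs_nbhs; split => //; exact: open_interior.
  exists (Num.truncn r^-1) => m nm v vm; apply: rT; apply: lt_le_trans vm _.
  rewrite invf_ple ?posrE //; apply: ltW; apply: lt_le_trans (truncnS_gt _) _.
  by rewrite ler_nat.
by exists n.+1%:R^-1.
Qed.

Lemma tiles_bounded : exists D : nat, forall T v, val T v -> `|v| <= D%:R.
Proof.
apply: (@uniform_tile_const (fun n T => forall v, val T v -> `|v| <= n%:R)) => T.
have [/compact_bounded[M [_ MT]] _ _] := tile_val T.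
exists (Num.truncn M).+1 => m nm v Tv.
apply: (MT m%:R) => //; apply: lt_le_trans (truncnS_gt _) _.
by rewrite ler_nat.
Qed.

(** The origin of a tile lies in its interior, so a tile placed at [v2] within
    the inradius of [v1] overlaps the interior of the tile placed at [v1]. *)
Lemma tiling_separated x (r : R) : tiling x ->
  (forall T v, `|v| < r -> interior (val T) v) ->
  forall T1 T2 v1 v2, x T1 v1 -> x T2 v2 -> `|v1 - v2| < r ->
    v1 = v2 /\ T1 = T2.
Proof.
move=> [_ _ xdisj] rP T1 T2 v1 v2 x1 x2 v12.
have [//|disj] := xdisj _ _ _ _ x1 x2.
suff : (interior (translate v1 (val T1)) `&` interior (translate v2 (val T2))) v2.
  by rewrite disj.
rewrite !interior_translate; split; rewrite translateE; apply: rP.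
  by rewrite distrC.
by rewrite subrr normr0; apply: le_lt_trans v12.
Qed.

Lemma tiling_finite_vertices x (rho : R) : tiling x ->
  finite_set [set v | `|v| <= rho /\ exists T, x T v].
Proof.
move=> xP; have [r r0 rP] := tiles_inradius.
apply: (@finite_separated _ _ _ rho r) => // [v []//|v w [_ [T1 x1]] [_ [T2 x2]] vw].
by have [] := tiling_separated xP rP x1 x2 vw.
Qed.

(** * Chains of neighbouring tiles *)

Definition tiled_region (V : set 'rV[R]_d) x : set 'rV[R]_d :=
  \bigcup_(w in V) \bigcup_(T in [set T | x T w]) translate w (val T).

Lemma closed_tiled_region V x : finite_set V -> closed (tiled_region V x).
Proof.
move=> fV; apply: closed_bigcup => // w _; apply: closed_bigcup.
  exact: sub_finite_set (@subsetT _ _) finite_tile_type.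
by move=> T _; apply: closed_translate; exact: tile_closed.
Qed.

(** The bound [k] does not depend on the tiling: it is the size of a net whose
    mesh is half the separation of vertices, so that distinct vertices are near
    distinct points of the net.  Adjacency of the tiles that meet the segment
    from [0] to [v] is read as a relation on the net.  The tiles reached from the
    root and the other ones cover disjoint closed parts of the segment; by
    connectedness all are reached, and a path without repetition has at most [k] steps. *)
Lemma vertex_sumset (rho : R) : exists k : nat,
  forall x, tiling x -> forall T0, x T0 0 -> forall T v, x T v -> `|v| <= rho ->
    sumset (displacements tiles) k v.
Proof.
have [r r0 rP] := tiles_inradius.
have [D DP] := tiles_bounded.
have r20 : 0 < r / 2 by lra.
have [s sP] := @ball_finite_net R d (rho + D%:R) (r / 2) r20.
exists (size s) => x xP T0 x0 T1 v1 x1 v1rho.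
have [xcl xcov _] := xP.
pose near_net (i : 'I_(size s)) w := `|w - nth 0 s i| < r / 2.
pose V w := exists T (t : R), [/\ x T w, 0 <= t <= 1 & val T (t *: v1 - w)].
have VR w : V w -> `|w| <= rho + D%:R.
  move=> [T [t [_ /andP[t0 t1] /DP Tw]]].
  rewrite -(subrK (t *: v1) w) addrC; apply: le_trans (ler_normD _ _) _.
  apply: lerD; last by rewrite distrC.
  rewrite normrZ ger0_norm //; apply: le_trans v1rho.
  by apply: ler_piMl.
have Vnear w : V w -> exists i, near_net i w.
  move=> /VR/sP[c cs wc]; rewrite -index_mem in cs.
  by exists (Ordinal cs); rewrite /near_net /= nth_index // -index_mem.
have near_inj i w w' : V w -> V w' -> near_net i w -> near_net i w' -> w = w'.
  move=> [T [_ [xw _ _]]] [T' [_ [xw' _ _]]] iw iw'.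
  have [] // := tiling_separated xP rP xw xw'.
  apply: le_lt_trans (ler_distD (nth 0 s i) _ _) _.
  by rewrite (splitr r) ltrD // distrC.
pose e : rel 'I_(size s) := fun i j => `[< exists w w',
  [/\ V w, V w', near_net i w, near_net j w' & adjacency x (w', w)] >].
have V0 : V 0.
  exists T0, 0; split=> //; first by rewrite lexx ler01.
  by rewrite scale0r subrr; exact: tile_mem0.
have [i0 i00] := Vnear _ V0.
pose A := [set w | V w /\ exists2 i, near_net i w & connect e i0 i].
pose S := [set t *: v1 | t in `[0, 1 : R]%classic].
have fV : finite_set V.
  apply: sub_finite_set (tiling_finite_vertices (rho + D%:R) xP).
  by move=> w Vw; split; [exact: VR|case: Vw => T [t [xw _ _]]; exists T].
have VA w : V w -> A w.
  move=> Vw; apply: contrapT => nAw; pose B := V `\` A.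
  have AB p : tiled_region A x p -> tiled_region B x p -> False.
    move=> [u [Vu [i iu i0i]] [T xu Tp]] [u' [Vu' nAu'] [T' xu' Tp']].
    apply: nAu'; split=> //; have [j ju'] := Vnear _ Vu'; exists j => //.
    apply: connect_trans i0i (connect1 _); apply/asboolP; exists u, u'.
    by split=> //; exists T', T; split => //; exists p.
  have SA : S `<=` tiled_region A x.
    apply: (@connected_sub_closed _ _ _ (tiled_region B x)) => //.
    - exact: segment_connected_rV.
    - by apply: closed_tiled_region; apply: sub_finite_set fV => u [].
    - by apply: closed_tiled_region; apply: sub_finite_set fV => u [].
    - move=> p [t /=]; rewrite in_itv /= => t01 tp.
      have : [set: 'rV[R]_d] p by [].
      rewrite xcov => -[T _ [u xu Tu]].
      have Vu : V u by exists T, t; rewrite tp -translateE.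
      have [Au|nAu] := pselect (A u); [left|right]; exists u => //; by exists T.
    - exists 0; split.
        by exists 0; [rewrite /= in_itv /= lexx ler01|rewrite scale0r].
      exists 0; last by exists T0 => //; rewrite translateE subrr; exact: tile_mem0.
      by split=> //; exists i0.
  have [T [t [xw t01 Tw]]] := Vw.
  apply: (AB (t *: v1)); first by apply: SA; exists t => //=; rewrite in_itv.
  by exists w => //; exists T => //; rewrite translateE.
have V1 : V v1.
  exists T1, 1; split=> //; first by rewrite ler01 lexx.
  by rewrite scale1r subrr; exact: tile_mem0.
have [_ [i iv1 /connectP[q eq lq]]] := VA _ V1.
case/shortenP: eq lq => {}q eq uq _ lq.
have E0 : displacements tiles 0.
  exists x; split=> //; exists (0, 0); last by rewrite subrr.
  exists T0, T0; split=> //=; exists 0.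
  by split; rewrite translateE subrr; exact: tile_mem0.
(* A vertex of [V] is determined by a point of the net near it, so a path on
   the net lifts to a chain of neighbouring tiles. *)
suff chain (p : seq 'I_(size s)) j w k : V w -> near_net j w -> path e j p ->
    sumset (displacements tiles) k w ->
    forall w', V w' -> near_net (last j p) w' ->
      sumset (displacements tiles) (k + size p) w'.
  have := chain q i0 0 0 V0 i00 eq erefl v1 V1; rewrite -lq => /(_ iv1).
  apply: sumset_le => //; rewrite add0n.
  have /= := max_card (mem (i0 :: q)).
  by rewrite (card_uniqP uq) card_ord /=; exact: ltnW.
elim: p j w k => [|j' p IHp] j w k Vw jw /=.
  by move=> _ Ew w' Vw' jw'; rewrite addn0 (near_inj _ _ _ Vw' Vw jw' jw).
case/andP=> /asboolP[u [u' [Vu Vu' ju j'u' uu']]] pathp Ew w' Vw' lw'.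
rewrite -addSnnS; apply: (IHp j' u') => //.
exists (u' - u); first by exists x; split=> //; exists (u', u).
by exists w => //; rewrite (near_inj _ _ _ Vw Vu jw ju) subrK.
Qed.

Definition rooted x := tiling x /\ exists T, x T 0.

Hypothesis tiles_flc : finite_local_complexity tiles.

Lemma finite_rooted_vertices (rho : R) :
  finite_set [set v | `|v| <= rho /\ exists2 x, rooted x & exists T, x T v].
Proof.
have [k kP] := vertex_sumset rho.
apply: sub_finite_set (finite_sumset k tiles_flc) => v [vrho [x [xP [T0 x0]] [T xv]]].
exact: (kP x xP T0 x0 T v xv vrho).
Qed.

(** * Limits of rooted tilings *)

(** An ultrafilter decides every point, so the limit of a sequence exists without
    extracting a subsequence. *)
Definition ultralimit (U : set_system nat) (a : nat -> tile_family tiles) :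
  tile_family tiles := fun T v => U [set n | a n T v].

(** Only finitely many pairs of a point of norm at most [rho] and a tile can
    occur in rooted tilings; the ultrafilter fixes the status of each of them,
    hence of all of them at once. *)
Lemma ultralimit_agree (U : set_system nat) (a : nat -> tile_family tiles)
    (rho : R) : UltraFilter U -> (forall n, rooted (a n)) ->
  U [set n | agree 0 rho (a n) (ultralimit U a)].
Proof.
move=> UF aP.
have fG := finite_rooted_vertices rho.
set G := [set v | _] in fG.
have fGT : finite_set (G `*` [set: tiles]).
  by apply: finite_setX => //; exact: finite_tile_type.
have UFF : ProperFilter U by exact: ultra_proper.
pose same (q : 'rV[R]_d * tiles) :=
  [set n | a n q.2 q.1 <-> ultralimit U a q.2 q.1].
have Usame q : U (same q).
  case: q => v T; have [Uv|Uv] := in_ultra_setVsetC [set n | a n T v] UF.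
    by apply: (filterS _ Uv) => n nv; split.
  have nl : ~ ultralimit U a T v.
    by move=> lv; have [k [/= + kv]] := filter_ex (filterI Uv lv); apply.
  by apply: (filterS _ Uv) => n nv; split.
have Uall : U (\bigcap_(q in G `*` [set: tiles]) same q).
  exact: filter_finite_bigcap.
apply: (filterS _ Uall) => n nP T v; rewrite subr0 => vrho; split=> [av|lv].
  by apply/(nP (v, T)) => //; split=> //; split=> //; exists (a n) => //; exists T.
have [k kv] := filter_ex lv.
by apply/(nP (v, T)) => //; split=> //; split=> //; exists (a k) => //; exists T.
Qed.

(** Each axiom of tilings, tested near given points, depends on a bounded region
    only, where the limit coincides with some term of the sequence. *)
Lemma ultralimit_rooted (U : set_system nat) (a : nat -> tile_family tiles) :
  UltraFilter U -> (forall n, rooted (a n)) -> rooted (ultralimit U a).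
Proof.
move=> UF aP; set l := ultralimit U a.
have near_a (rho : R) : exists n, agree 0 rho (a n) l.
  have UFF : ProperFilter U by exact: ultra_proper.
  by have [n nP] := filter_ex (@ultralimit_agree U a rho UF aP); exists n.
have [D DP] := tiles_bounded.
split; last first.
  have [n nP] := near_a 0; have [_ [T aT]] := aP n.
  by exists T; apply/(nP T 0) => //; rewrite subrr normr0.
split.
- move=> T v clv; have [n nP] := near_a (`|v| + 1).
  have [[acl _ _] _] := aP n.
  apply/(nP T v); first by rewrite subr0 lerDl.
  apply: acl => B Bv.
  have Bv' : nbhs v (B `&` [set w | `|v - w| < 1]).
    apply: filterI => //; apply/(nbhs_normP v); exists 1 => //=.
  have [w [lw [Bw vw]]] := clv _ Bv'; exists w; split=> //.
  apply/(nP T w) => //; rewrite subr0.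
  by rewrite -(subrK v w) addrC; apply: le_trans (ler_normD _ _) _;
    rewrite lerD2l distrC ltW.
- apply/seteqP; split=> // p _; have [n nP] := near_a (`|p| + D%:R).
  have [[_ acov _] _] := aP n.
  have : [set: 'rV[R]_d] p by [].
  rewrite acov => -[T _ [v av]]; rewrite translateE => Tv.
  exists T => //; exists v; last by rewrite translateE.
  apply/(nP T v) => //; rewrite subr0 -(subrK p v) addrC.
  apply: le_trans (ler_normD _ _) _.
  by rewrite lerD2l distrC; exact: DP Tv.
- move=> T1 T2 v1 v2 l1 l2; have [n nP] := near_a (`|v1| + `|v2|).
  have [[_ _ adisj] _] := aP n.
  apply: adisj; first by apply/(nP T1 v1) => //; rewrite subr0 lerDl.
  by apply/(nP T2 v2) => //; rewrite subr0 lerDr.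
Qed.

(** * Finiteness *)

(** Under the hypothesis a rooted tiling is determined by its trace on a ball,
    which is a subset of a fixed finite set. *)
Lemma finite_rooted_of_agree (rho : R) :
  (forall x y, rooted x -> rooted y -> agree 0 rho x y -> x = y) ->
  finite_set [set x : tile_family tiles | rooted x].
Proof.
move=> inj.
pose G := [set v | `|v| <= rho /\ exists2 x, rooted x & exists T, x T v].
have fG : finite_set G by exact: finite_rooted_vertices.
pose f x := [set q : 'rV[R]_d * tiles | `|q.1| <= rho /\ x q.2 q.1].
have /inj_card_eq/eq_finite_set <- :
    {in [set x : tile_family tiles | rooted x] &, injective f}.
  move=> x y /set_mem xr /set_mem yr fxy; apply: inj => // T v.
  rewrite subr0 => vrho.
  have : f x (v, T) = f y (v, T) by rewrite fxy.
  by rewrite /f /= => /propeqP[xy yx]; split=> [xv|yv]; [case: xy|case: yx].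
apply: (@sub_finite_set _ _ [set B | B `<=` G `*` [set: tiles]]).
  move=> _ [x xr <-] [v T] [/= vrho xv]; split=> //; split=> //.
  by exists x => //; exists T.
by apply: finite_subsets; apply: finite_setX => //; exact: finite_tile_type.
Qed.

(** Let [j] be the largest integer such that [x] and [y] agree on the ball of
    radius [j], and [v] a point of disagreement with norm at most [j + 1].  The
    tile of [x] that covers a point [p] slightly closer to the origin than [v]
    has its vertex [u] in the ball of radius [j], so [u] is common to [x] and
    [y]; it becomes the new origin.  The ball of radius [j] is then centred at
    [- u] and contains the balls of radius [m <= j] centred at [- (m / j) u]. *)
Lemma recentre (D n : nat) x y : (forall T v, val T v -> `|v| <= D%:R) ->
  rooted x -> rooted y -> agree 0 (n + D)%:R x y -> x <> y ->
  exists x' y', [/\ rooted x', rooted y',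
    ~ agree 0 (D + D).+1%:R x' y' &
    forall m : nat, (m <= n)%N -> exists2 c, `|c| <= m%:R & agree c m%:R x' y'].
Proof.
move=> DP [xP [Tx _]] [yP _] xyn xy.
have : exists k : nat, `[< ~ agree 0 k%:R x y >].
  apply: contrapT => /forallNP allk; apply: xy; apply/funext => T.
  apply/seteqP.
  suff xyE v : x T v <-> y T v by split=> v /xyE.
  have xyk : agree 0 (Num.truncn `|v|).+1%:R x y.
    by apply: contrapT => nxy; apply: (allk (Num.truncn `|v|).+1); apply/asboolP.
  by apply: xyk; rewrite subr0 ltW // truncnS_gt.
move=> /ex_minnP[k /asboolP kP kmin].
have nDk : (n + D < k)%N.
  rewrite ltnNge; apply/negP => kn; apply: kP => T v vk; apply: xyn.
  by apply: le_trans vk _; rewrite ler_nat.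
case: k => [//|j] in kP kmin nDk *.
have xyj : agree 0 j%:R x y.
  apply: contrapT => nxy.
  by have := kmin j (introT (asboolP _) nxy); rewrite ltnn.
have [T [v [vj nv]]] : exists T v, `|v| <= j.+1%:R /\ ~ (x T v <-> y T v).
  apply: contrapT => nv; apply: kP => T v; rewrite subr0 => vj.
  by apply: contrapT => xyv; apply: nv; exists T, v.
have Dj : (D <= j)%N by apply: leq_trans (leq_addl n D) _.
(* [p] is [v] moved towards the origin: its norm is at most [j - D], so that a
   tile covering it has its vertex in the ball of radius [j], while [v - p] has
   norm at most [D + 1]. *)
pose t : R := (j - D)%:R / j.+1%:R.
have j0 : (0 : R) < j.+1%:R by rewrite ltr0n.
have t0 : 0 <= t by rewrite divr_ge0.
have tj : t * j.+1%:R = (j - D)%:R by rewrite divfK // gt_eqF.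
have t1 : t <= 1.
  by rewrite ler_pdivrMr // mul1r ler_nat (leq_trans (leq_subr _ _)).
pose p := t *: v.
have pj : `|p| <= (j - D)%:R by rewrite normrZ ger0_norm // -tj ler_wpM2l.
have pv : `|v - p| <= D.+1%:R.
  rewrite -[X in X - _]scale1r -scalerBl normrZ ger0_norm ?subr_ge0 //.
  have -> : D.+1%:R = (1 - t) * j.+1%:R :> R.
    by rewrite mulrBl mul1r tj natrB // -[in LHS]natr1 -[in RHS]natr1; lra.
  by apply: ler_wpM2l => //; rewrite subr_ge0.
have [xcl xcov _] := xP.
have : [set: 'rV[R]_d] p by [].
rewrite xcov => -[Tu _ [u xu]]; rewrite translateE => /DP pu.
have uj : `|u| <= j%:R.
  rewrite -(subrK p u) -(subnK Dj) natrD addrC; apply: le_trans (ler_normD _ _) _.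
  by apply: lerD => //; rewrite distrC.
have yu : y Tu u by apply/xyj => //; rewrite subr0.
exists (translate_family (- u) x), (translate_family (- u) y); split.
- by split; [exact: tiling_translate|exists Tu; rewrite translate_familyE opprK add0r].
- by split; [exact: tiling_translate|exists Tu; rewrite translate_familyE opprK add0r].
- move=> /(_ T (v - u)); rewrite !translate_familyE opprK subrK => H; apply: nv.
  apply: H; rewrite subr0; apply: le_trans (ler_distD p _ _) _.
  by rewrite -addSn natrD lerD.
- move=> m mn; have mj : (m <= j)%N.
    by apply: leq_trans mn _; apply: leq_trans (leq_addr D n) _.
  (* If [j = 0] then [m = 0] and [u = 0], and [s = 0 / 0 = 0] is harmless. *)
  pose s : R := m%:R / j%:R.
  have s0 : 0 <= s by rewrite divr_ge0.
  have s1 : s <= 1.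
    rewrite /s; case: (posnP j) => [->|jp]; first by rewrite invr0 mulr0.
    by rewrite ler_pdivrMr ?ltr0n // mul1r ler_nat.
  have sj : s * j%:R = m%:R.
    rewrite /s; case: (posnP j) => [j0'|jp].
      by move: mj; rewrite j0' leqn0 => /eqP ->; rewrite mulr0.
    by rewrite divfK // pnatr_eq0 -lt0n.
  exists (- (s *: u)).
    by rewrite normrN normrZ ger0_norm // -sj ler_wpM2l.
  move=> T' w; rewrite opprK => ws; rewrite !translate_familyE opprK.
  apply: xyj; rewrite subr0.
  have -> : w + u = (w + s *: u) + (1 - s) *: u.
    by rewrite scalerBl scale1r [u - _]addrC addrA addrK.
  apply: le_trans (ler_normD _ _) _.
  have -> : j%:R = m%:R + (1 - s) * j%:R :> R by rewrite mulrBl mul1r sj; lra.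
  apply: lerD => //; rewrite normrZ ger0_norm ?subr_ge0 //.
  by apply: ler_wpM2l => //; rewrite subr_ge0.
Qed.

Lemma finite_rooted :
  (forall x, tiling x -> periodic_tiling x) ->
  finite_set [set x : tile_family tiles | rooted x].
Proof.
move=> periodic; apply: contrapT => infinite.
have [D DP] := tiles_bounded.
pose good (n : nat) (z : tile_family tiles * tile_family tiles) :=
  [/\ rooted z.1, rooted z.2, ~ agree 0 (D + D).+1%:R z.1 z.2 &
  forall m : nat, (m <= n)%N -> exists2 c, `|c| <= m%:R & agree c m%:R z.1 z.2].
have /choice[z zP] n : exists z, good n z.
  apply: contrapT => nogood; apply: infinite.
  apply: (@finite_rooted_of_agree (n + D)%:R) => x y xr yr xyn.
  apply: contrapT => xy; apply: nogood.
  by have [x' [y' ?]] := recentre DP xr yr xyn xy; exists (x', y').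
have [U [UF ooU]] := @ultraFilterLemma _ \oo _.
have UPF : ProperFilter U by exact: ultra_proper.
pose a := ultralimit U (fun n => (z n).1).
pose b := ultralimit U (fun n => (z n).2).
have za n : rooted (z n).1 by have [] := zP n.
have zb n : rooted (z n).2 by have [] := zP n.
have [aT _] := ultralimit_rooted UF za.
have [bT _] := ultralimit_rooted UF zb.
have Uab (rho : R) (m : nat) : exists n,
    [/\ (m <= n)%N, agree 0 rho (z n).1 a & agree 0 rho (z n).2 b].
  have Um : U [set n | (m <= n)%N] by apply: ooU; exact: nbhs_infty_ge.
  have [n [mn [na nb]]] := filter_ex (filterI Um (filterI
    (ultralimit_agree rho UF za) (ultralimit_agree rho UF zb))).
  by exists n.
have ab : a = b.
  apply: periodic_eq_of_agree; [exact: periodic|exact: periodic|] => r.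
  pose m := (Num.truncn r).+1; have rm : r <= m%:R by rewrite ltW // truncnS_gt.
  (* A ball of agreement of radius [m] of the [n]-th pair lies in the ball of
     radius [2 m] around the origin, where the pair coincides with its limit. *)
  have [n [mn na nb]] := Uab (m%:R + m%:R) m.
  have [_ _ _ /(_ m mn)[c cm nab]] := zP n; exists c => T v vc.
  have vm : `|v - c| <= m%:R by exact: le_trans rm.
  have v0 : `|v - 0| <= m%:R + m%:R.
    by rewrite subr0 -(subrK c v); apply: le_trans (ler_normD _ _) _; rewrite lerD.
  by rewrite -(na T v v0) -(nb T v v0); exact: nab.
have [n [_ na nb]] := Uab (D + D).+1%:R 0%N.
have [_ _ nab _] := zP n; apply: nab => T v v0.
by rewrite (na T v v0) ab (nb T v v0).
Qed.

End Tilings.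

Theorem theorem6p16 (R : realType) (d : nat) (tiles : set (set 'rV[R]_d))
    (tiles_finite : finite_set tiles)
    (tilesP : forall T, tiles T -> tile T)
    (tiles_flc : finite_local_complexity tiles)
    (tilings_periodic : forall x : tile_family tiles, tiling x -> periodic_tiling x) :
  finite_set [set translation_orbit x | x in [set x : tile_family tiles | tiling x]].
Proof.
have fX := finite_rooted tiles_finite tilesP tiles_flc tilings_periodic.
apply: sub_finite_set (finite_image (@translation_orbit R d tiles) fX).
move=> _ [x xP <-]; have [_ xcov _] := xP.
have : [set: 'rV[R]_d] 0 by [].
rewrite xcov => -[T _ [v xv _]].
exists (translate_family (- v) x).
  split; first exact: tiling_translate.
  by exists T; rewrite translate_familyE opprK add0r.
apply/seteqP; split=> _ [u _ <-].
  by exists (u - v) => //; rewrite translate_familyD.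
by exists (u + v) => //; rewrite -translate_familyD addrK.
Qed.
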